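(* For all positive integers $q$ and $n$, the following four infinite product identities hold: \[ \prod_{k = 1}^\infty \frac{F_{4n(2k + q - 1)} + F_{4nq} }{F_{4n(2k + q - 1)} - F_{4nq} } = \frac{1}{(\sqrt 5)^q }\prod_{k = 1}^q \frac{L_{2n(2k - 1)} }{F_{2n(2k - 1)} }, \] \[ \prod_{k = 1}^\infty \frac{F_{(4n - 2)(2k + q - 1)} + F_{2q(2n - 1)} }{F_{(4n - 2)(2k + q - 1)} - F_{2q(2n - 1)} } = (\sqrt 5)^q \prod_{k = 1}^q \frac{F_{(2n - 1)(2k - 1)} }{L_{(2n - 1)(2k - 1)} }, \] \[ \prod_{k = 1}^\infty \frac{L_{(2k - 1 + 2q)(2n - 1)} + \sqrt 5 F_{2q(2n - 1)} }{L_{(2k - 1 + 2q)(2n - 1)} - \sqrt 5 F_{2q(2n - 1)} } = \prod_{k = 1}^{2q} \frac{F_{(2k - 1)(2n - 1)} \sqrt 5 + 2}{L_{(2k - 1)(2n - 1)} }, \] \[ \prod_{k = 1}^\infty \frac{\sqrt 5 F_{2(2n-1)(k + q - 1)} + L_{(2n - 1)(2q - 1)} }{\sqrt 5 F_{2(2n-1)(k + q - 1)} - L_{(2n - 1)(2q - 1)} } = \prod_{k = 1}^{2q - 1} \frac{F_{(2k - 1)(2n - 1)} \sqrt 5 + 2}{L_{(2k - 1)(2n - 1)} }. \]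
   Context: The Fibonacci numbers $F_j$ and Lucas numbers $L_j$ are defined for integers $j\ge 0$ by $F_0=0$, $F_1=1$, $F_j=F_{j-1}+F_{j-2}$ and $L_0=2$, $L_1=1$, $L_j=L_{j-1}+L_{j-2}$. Here $\sqrt5$ is the positive real square root of $5$. *)

(* Defs.v *)
From HB Require Import structures.
From mathcomp Require Export all_boot all_order all_algebra.
From mathcomp Require Export classical_sets reals topology normedtype sequences.

Set Implicit Arguments.
Unset Strict Implicit.
Unset Printing Implicit Defensive.

Export Order.TTheory GRing.Theory Num.Theory.
Export numFieldNormedType.Exports.

Local Open Scope classical_set_scope.
Local Open Scope ring_scope.

Fixpoint fib (j : nat) : nat :=
  match j with
  | 0 => 0
  | j1.+1 => match j1 with 0 => 1 | j2.+1 => fib j1 + fib j2 end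
  end%N.

Fixpoint lucas (j : nat) : nat :=
  match j with
  | 0 => 2
  | j1.+1 => match j1 with 0 => 1 | j2.+1 => lucas j1 + lucas j2 end
  end%N.

Arguments fib j%_nat_scope.
Arguments lucas j%_nat_scope.

(* [infprod_eq u l]: the partial products u 1 * ... * u N converge to l as N
   tends to infinity. A nonzero limit is not required separately, so this is
   the usual notion of convergence of an infinite product only for l != 0. *)
Definition infprod_eq (R : realType) (u : nat -> R) (l : R) : Prop :=
  (fun N : nat => \prod_(1 <= k < N.+1) u k) @ \oo --> l.

(* Main.v *)
(* Writing theta = ln phi with phi the golden ratio, Binet's formulas say that
   sqrt 5 * F_j and L_j are 2 sinh (j theta) or 2 cosh (j theta), according to
   the parity of j. In each of the four products the general term is therefore
   (sinh a + sinh b) / (sinh a - sinh b)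
     = tanh ((a + b) / 2) / tanh ((a - b) / 2),
   which has the form g (k + s) / g k with g k = tanh (h (2 k - 1)). Since
   g k tends to 1, the product telescopes to \prod_(1 <= k <= s) 1 / g k. With
   x = exp (2 h) one has g k = (x ^ (2 k - 1) - 1) / (x ^ (2 k - 1) + 1). *)
Require Import Defs.
From mathcomp Require Import boolp ring lra zify.

Local Open Scope classical_set_scope.
Local Open Scope ring_scope.

(** * Telescoping infinite products *)

Lemma eq_infprod {R : realType} {u v : nat -> R} {l : R} :
  (forall k, (0 < k)%N -> u k = v k) -> infprod_eq u l -> infprod_eq v l.
Proof.
move=> uv; rewrite /infprod_eq.
suff -> : (fun N : nat => \prod_(1 <= k < N.+1) u k) =
          (fun N : nat => \prod_(1 <= k < N.+1) v k) by [].
by apply/funext => N; apply: eq_big_nat => k /andP[k0 _]; exact: uv.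
Qed.

(** Induction on [s]: passing from [s] to [s.+1] multiplies the partial product by the product of
    [g (k + s.+1) / g (k + s)]. This telescopes to [g (N + s.+1) / g s.+1], which tends to
    [(g s.+1)^-1]. *)
Lemma infprod_telescope {R : realType} {g : nat -> R} (s : nat) :
  (forall k, (0 < k)%N -> g k != 0) -> g @ \oo --> (1 : R) ->
  infprod_eq (fun k => g (k + s)%N / g k) (\prod_(1 <= k < s.+1) (g k)^-1).
Proof.
move=> g0 g1; elim: s => [|s IHs].
  rewrite big_geq // /infprod_eq.
  apply: (@cvg_trans _ ((fun=> 1 : R) @ \oo)); last exact: cvg_cst.
  apply: near_eq_cvg; near=> N; rewrite big_nat big1 // => k /andP[k0 _].
  by rewrite addn0 divff // g0.
rewrite big_nat_recr //= /infprod_eq -[(g s.+1)^-1]mul1r.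
rewrite (_ : (fun N => _) = (fun N => (\prod_(1 <= k < N.+1) (g (k + s)%N / g k))
    * (g (N + s.+1)%N * (g s.+1)^-1))); last first.
  apply/funext => -[|N].
    (* The telescoping lemma needs a nonempty range, so the empty product is treated apart. *)
    by rewrite !big_geq // mul1r add0n divff // g0.
  rewrite -(addSnnS N.+1 s) -[s.+1]add1n.
  rewrite -(@telescope_prodf _ 1 N.+2 (fun k => g (k + s)%N)) //; last first.
    by move=> k /andP[k0 _]; rewrite g0 // addn_gt0 (ltnW k0).
  rewrite -big_split /=; apply: eq_big_nat => k /andP[k0 _].
  rewrite add1n -addSnnS; field.
  by rewrite !g0 // addn_gt0 k0.
apply: cvgM; first exact: IHs.
apply: cvgM; last exact: cvg_cst.
by rewrite (cvg_shiftn s.+1 g (nbhs (1 : R))).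
Unshelve. all: by end_near.
Qed.

(** Dividing through by the power of [x] leaves 1 plus or minus a geometric sequence of ratio
    [x ^- 2], which is below 1. *)
Lemma cvg_tanh_odd {R : realType} {x : R} : 1 < x ->
  (fun k => (x ^+ (2 * k - 1) - 1) / (x ^+ (2 * k - 1) + 1)) @ \oo --> (1 : R).
Proof.
move=> x1; have x0 : 0 < x by lra.
(* Truncated subtraction makes [2 * k - 1] equal to 0 at [k = 0]; after a shift by one the exponent
   is the genuine [2 * k + 1]. *)
rewrite -(cvg_shiftn 1%N) /=.
rewrite (_ : (fun k => _) = (fun k => (1 - x^-1 * (x^-1 ^+ 2) ^+ k)
    / (1 + x^-1 * (x^-1 ^+ 2) ^+ k))); last first.
  apply/funext => k; rewrite (_ : (2 * (k + 1) - 1 = (2 * k).+1)%N); last by lia.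
  rewrite -exprM -exprS exprVn; have := exprn_gt0 (2 * k).+1 x0.
  by set y := x ^+ _ => y0; field; rewrite !gt_eqF //; lra.
have z0 : x^-1 * (x^-1 ^+ 2) ^+ k @[k --> \oo] --> 0.
  rewrite -[0](mulr0 x^-1); apply: cvgM; first exact: cvg_cst.
  apply: cvg_expr; rewrite ger0_norm ?sqr_ge0 //.
  by rewrite expr_lt1 ?invf_lt1 // invr_ge0 ltW.
have : (1 - x^-1 * (x^-1 ^+ 2) ^+ k) / (1 + x^-1 * (x^-1 ^+ 2) ^+ k)
    @[k --> \oo] --> ((1 - 0) / (1 + 0) : R).
  apply: cvgM; first by apply: cvgB => //; exact: cvg_cst.
  by apply: cvgV; [rewrite addr0 oner_eq0|apply: cvgD => //; exact: cvg_cst].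
by rewrite subr0 addr0 divr1.
Qed.

(* The factor [c] absorbs the [sqrt 5] of Binet's formula. *)
Lemma infprod_sinh {R : realType} {x c : R} {s : nat} {a : nat -> R} {b : R} :
  1 < x -> c != 0 ->
  (forall k, (0 < k)%N ->
     c * a k = x ^+ (2 * k - 1 + s) - x ^- (2 * k - 1 + s)) ->
  c * b = x ^+ s - x ^- s ->
  infprod_eq (fun k => (a k + b) / (a k - b))
    (\prod_(1 <= k < s.+1) ((x ^+ (2 * k - 1) + 1) / (x ^+ (2 * k - 1) - 1))).
Proof.
move=> x1 c0 aE bE; have x0 : 0 < x by lra.
pose g k := (x ^+ (2 * k - 1) - 1) / (x ^+ (2 * k - 1) + 1).
have odd_gt1 k : (0 < k)%N -> 1 < x ^+ (2 * k - 1).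
  by move=> k0; rewrite exprn_egt1 //; lia.
have g0 k : (0 < k)%N -> g k != 0.
  move=> /odd_gt1 A1; rewrite /g mulf_neq0 ?invr_eq0 // gt_eqF //; lra.
rewrite (_ : \prod_(_ <= _ < _) _ = \prod_(1 <= k < s.+1) (g k)^-1); last first.
  by apply: eq_big_nat => k _; rewrite /g invf_div.
apply: eq_infprod (infprod_telescope s g0 (cvg_tanh_odd x1)) => k k0.
rewrite (_ : (a k + b) / (a k - b) = (c * a k + c * b) / (c * a k - c * b)); last first.
  by rewrite -mulrDr -mulrBr -mulf_div divff // mul1r.
rewrite aE // bE /g.
rewrite (_ : (2 * (k + s) - 1 = 2 * k - 1 + s + s)%N); last by lia.
rewrite !exprD; have := odd_gt1 _ k0; have := exprn_gt0 s x0.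
set A := x ^+ (2 * k - 1); set B := x ^+ s => B0 A1.
have ABB0 : 0 < A * B * B by rewrite !mulr_gt0 //; lra.
(* Sum-to-product in exponential form: the factors [A + 1] and [A - 1] build [g k], while
   [A * B * B - 1] and [A * B * B + 1] build [g (k + s)]. *)
rewrite (_ : A * B - (A * B)^-1 + (B - B^-1)
           = (A + 1) * (A * B * B - 1) / (A * B)); last first.
  by field; rewrite !gt_eqF //; lra.
rewrite (_ : A * B - (A * B)^-1 - (B - B^-1)
           = (A - 1) * (A * B * B + 1) / (A * B)); last first.
  by field; rewrite !gt_eqF //; lra.
by field; rewrite !gt_eqF //; lra.
Qed.

(** * The golden ratio and Binet's formulas *)

Definition golden (R : realType) : R := (1 + Num.sqrt 5) / 2.

Lemma sqrt5_gt0 (R : realType) : 0 < Num.sqrt 5 :> R.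
Proof. by rewrite sqrtr_gt0 ltr0n. Qed.

Lemma golden_gt1 (R : realType) : 1 < golden R.
Proof.
have : 1 < Num.sqrt 5 :> R by rewrite -[X in X < _]sqrtr1 ltr_sqrt ?ltr1n ?ltr0n.
by rewrite /golden; lra.
Qed.

Lemma golden_gt0 (R : realType) : 0 < golden R.
Proof. exact: lt_trans ltr01 (golden_gt1 R). Qed.

Lemma golden_pow_gt1 (R : realType) (j : nat) : (0 < j)%N -> 1 < golden R ^+ j.
Proof. by move=> j0; rewrite exprn_egt1 ?golden_gt1 // -lt0n. Qed.

Lemma golden_sqr (R : realType) : golden R ^+ 2 = golden R + 1.
Proof.
have s5 : Num.sqrt 5 ^+ 2 = 5 :> R by rewrite sqr_sqrtr // ler0n.
by rewrite /golden; field: s5.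
Qed.

Lemma golden_inv (R : realType) : (golden R)^-1 = golden R - 1.
Proof.
have g0 := golden_gt0 R; apply: (mulfI (lt0r_neq0 g0)); rewrite mulfV ?gt_eqF //.
by rewrite mulrBr -expr2 golden_sqr; ring.
Qed.

Lemma binet_fib (R : realType) (j : nat) :
  Num.sqrt 5 * (fib j)%:R = golden R ^+ j - (- (golden R)^-1) ^+ j.
Proof.
(* With the conjugate root written as [1 - golden R], the induction step is a polynomial identity
   modulo [golden_sqr]. *)
rewrite golden_inv.
suff [] : Num.sqrt 5 * (fib j)%:R = golden R ^+ j - (- (golden R - 1)) ^+ j /\
  Num.sqrt 5 * (fib j.+1)%:R = golden R ^+ j.+1 - (- (golden R - 1)) ^+ j.+1 by [].
elim: j => [|j [IH0 IH1]]; first by split; rewrite /= /golden; field.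
split=> //; rewrite [fib j.+2]/(fib j.+1 + fib j)%N natrD mulrDr IH0 IH1 !exprS.
by have := golden_sqr R => gg; ring: gg.
Qed.

Lemma binet_lucas (R : realType) (j : nat) :
  (lucas j)%:R = golden R ^+ j + (- (golden R)^-1) ^+ j.
Proof.
rewrite golden_inv.
suff [] : (lucas j)%:R = golden R ^+ j + (- (golden R - 1)) ^+ j /\
  (lucas j.+1)%:R = golden R ^+ j.+1 + (- (golden R - 1)) ^+ j.+1 by [].
elim: j => [|j [IH0 IH1]]; first by split; rewrite /=; ring.
split=> //; rewrite [lucas j.+2]/(lucas j.+1 + lucas j)%N natrD IH0 IH1 !exprS.
by have := golden_sqr R => gg; ring: gg.
Qed.

Lemma binet_parity (R : realType) (j : nat) :
  (- (golden R)^-1) ^+ j = (-1) ^+ odd j * golden R ^- j.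
Proof. by rewrite signr_odd -exprVn -exprNn. Qed.

Lemma fib_even (R : realType) (j : nat) : ~~ odd j ->
  Num.sqrt 5 * (fib j)%:R = golden R ^+ j - golden R ^- j.
Proof. by move=> /negbTE jE; rewrite binet_fib binet_parity jE expr0 mul1r. Qed.

Lemma fib_odd (R : realType) (j : nat) : odd j ->
  Num.sqrt 5 * (fib j)%:R = golden R ^+ j + golden R ^- j.
Proof. by move=> jO; rewrite binet_fib binet_parity jO expr1 mulN1r opprK. Qed.

Lemma lucas_even (R : realType) (j : nat) : ~~ odd j ->
  (lucas j)%:R = golden R ^+ j + golden R ^- j.
Proof. by move=> /negbTE jE; rewrite binet_lucas binet_parity jE expr0 mul1r. Qed.

Lemma lucas_odd (R : realType) (j : nat) : odd j ->
  (lucas j)%:R = golden R ^+ j - golden R ^- j.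
Proof. by move=> jO; rewrite binet_lucas binet_parity jO expr1 mulN1r. Qed.

(** * Factors of the finite products as hyperbolic cotangents *)

(** For [z = golden R ^+ j] the left side is [(z + z^-1) / (z - z^-1)]. Positivity of [j] gives
    [z > 1], so no denominator vanishes. *)
Lemma coth_even (R : realType) (j : nat) : (0 < j)%N -> ~~ odd j ->
  (golden R ^+ (2 * j) + 1) / (golden R ^+ (2 * j) - 1)
  = (Num.sqrt 5)^-1 * ((lucas j)%:R / (fib j)%:R).
Proof.
move=> j0 jE; rewrite mulrCA -invfM fib_even // lucas_even // mulnC exprM.
have := golden_pow_gt1 R j j0.
by set z := golden R ^+ j => z1; field; rewrite !gt_eqF //; nra.
Qed.

(** Same quotient as for even [j], but odd parity exchanges the roles of [fib] and [lucas] in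
    Binet's formulas, so [Num.sqrt 5] moves to the numerator. *)
Lemma coth_odd (R : realType) (j : nat) : odd j ->
  (golden R ^+ (2 * j) + 1) / (golden R ^+ (2 * j) - 1)
  = Num.sqrt 5 * ((fib j)%:R / (lucas j)%:R).
Proof.
move=> jO; rewrite mulrA fib_odd // lucas_odd // mulnC exprM.
have := golden_pow_gt1 R j (odd_gt0 jO).
by set z := golden R ^+ j => z1; field; rewrite !gt_eqF //; nra.
Qed.

(** Half-angle formula coth (u / 2) = (cosh u + 1) / sinh u: multiplying both terms of the quotient
    by [z + 1], then dividing by [z], gives [(z + z^-1 + 2) / (z - z^-1)]. *)
Lemma coth_half_odd (R : realType) (j : nat) : odd j ->
  (golden R ^+ j + 1) / (golden R ^+ j - 1)
  = ((fib j)%:R * Num.sqrt 5 + 2) / (lucas j)%:R.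
Proof.
move=> jO; rewrite mulrC [in RHS]mulrC [X in X + 2]mulrC fib_odd // lucas_odd //.
have := golden_pow_gt1 R j (odd_gt0 jO).
by set z := golden R ^+ j => z1; field; rewrite !gt_eqF //; nra.
Qed.

Theorem theorem2 (R : realType) (q n : nat) (hq : (0 < q)%N) (hn : (0 < n)%N) :
  [/\ infprod_eq
        (fun k : nat =>
           ((fib (4 * n * (2 * k + q - 1)))%:R + (fib (4 * n * q))%:R)
           / ((fib (4 * n * (2 * k + q - 1)))%:R - (fib (4 * n * q))%:R))
        (1 / (Num.sqrt 5 : R) ^+ q
         * \prod_(1 <= k < q.+1)
             ((lucas (2 * n * (2 * k - 1)))%:R / (fib (2 * n * (2 * k - 1)))%:R)),
      infprod_eq
        (fun k : nat =>
           ((fib ((4 * n - 2) * (2 * k + q - 1)))%:R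
              + (fib (2 * q * (2 * n - 1)))%:R)
           / ((fib ((4 * n - 2) * (2 * k + q - 1)))%:R
              - (fib (2 * q * (2 * n - 1)))%:R))
        ((Num.sqrt 5 : R) ^+ q
         * \prod_(1 <= k < q.+1)
             ((fib ((2 * n - 1) * (2 * k - 1)))%:R
              / (lucas ((2 * n - 1) * (2 * k - 1)))%:R)),
      infprod_eq
        (fun k : nat =>
           ((lucas ((2 * k - 1 + 2 * q) * (2 * n - 1)))%:R
              + Num.sqrt 5 * (fib (2 * q * (2 * n - 1)))%:R)
           / ((lucas ((2 * k - 1 + 2 * q) * (2 * n - 1)))%:R
              - Num.sqrt 5 * (fib (2 * q * (2 * n - 1)))%:R))
        (\prod_(1 <= k < (2 * q).+1)
           (((fib ((2 * k - 1) * (2 * n - 1)))%:R * (Num.sqrt 5 : R) + 2)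
            / (lucas ((2 * k - 1) * (2 * n - 1)))%:R))
    & infprod_eq
        (fun k : nat =>
           (Num.sqrt 5 * (fib (2 * (2 * n - 1) * (k + q - 1)))%:R
              + (lucas ((2 * n - 1) * (2 * q - 1)))%:R)
           / (Num.sqrt 5 * (fib (2 * (2 * n - 1) * (k + q - 1)))%:R
              - (lucas ((2 * n - 1) * (2 * q - 1)))%:R))
        (\prod_(1 <= k < (2 * q - 1).+1)
           (((fib ((2 * k - 1) * (2 * n - 1)))%:R * (Num.sqrt 5 : R) + 2)
            / (lucas ((2 * k - 1) * (2 * n - 1)))%:R))].
Proof.
have c0 : Num.sqrt 5 != 0 :> R by rewrite gt_eqF // sqrt5_gt0.
split.
(* Here [x = golden R ^+ (4 * n)], [s = q], [c = Num.sqrt 5]. The outer power of [Num.sqrt 5] is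
   spread over the [q] factors, one for each cotangent. *)
- rewrite (_ : 1 / _ * _ = \prod_(1 <= k < q.+1)
      (((golden R ^+ (4 * n)) ^+ (2 * k - 1) + 1)
       / ((golden R ^+ (4 * n)) ^+ (2 * k - 1) - 1))); last first.
    rewrite div1r -exprVn (_ : _ ^+ q = \prod_(1 <= k < q.+1) (Num.sqrt 5)^-1);
      last by rewrite prodr_const_nat subn1.
    rewrite -big_split /=.
    apply: eq_big_nat => k /andP[k0 _]; rewrite -coth_even; [|nia|by rewrite !oddM].
    by rewrite -exprM; congr (_ / _); congr (golden R ^+ _ + _); nia.
  apply: (infprod_sinh (golden_pow_gt1 R _ _) c0) => [|k k0|]; first lia.
  + rewrite -!exprM fib_even; last by rewrite !oddM; lia.
    by rewrite (_ : (2 * k + q - 1 = 2 * k - 1 + q)%N) //; lia.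
  + by rewrite -!exprM fib_even // !oddM; lia.
(* Now [x = golden R ^+ (4 * n - 2)]: the indices on the left stay even, but those on the right,
   [(2 * n - 1) * (2 * k - 1)], are odd. *)
- rewrite (_ : _ ^+ q * _ = \prod_(1 <= k < q.+1)
      (((golden R ^+ (4 * n - 2)) ^+ (2 * k - 1) + 1)
       / ((golden R ^+ (4 * n - 2)) ^+ (2 * k - 1) - 1))); last first.
    rewrite (_ : _ ^+ q = \prod_(1 <= k < q.+1) Num.sqrt 5);
      last by rewrite prodr_const_nat subn1.
    rewrite -big_split /=.
    apply: eq_big_nat => k /andP[k0 _]; rewrite -coth_odd; last by rewrite oddM; lia.
    by rewrite -exprM; congr (_ / _); congr (golden R ^+ _ + _); nia.
  apply: (infprod_sinh (golden_pow_gt1 R _ _) c0) => [|k k0|]; first lia.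
  + rewrite -!exprM fib_even; last by rewrite !oddM; lia.
    by rewrite (_ : (2 * k + q - 1 = 2 * k - 1 + q)%N) //; lia.
  + rewrite -!exprM (_ : (2 * q * (2 * n - 1) = (4 * n - 2) * q)%N); last nia.
    by rewrite fib_even // !oddM; lia.
(* The terms already carry [Num.sqrt 5], hence [c = 1]; [x = golden R ^+ (2 * n - 1)] is an odd
   power and [s = 2 * q], so [a k] is an odd Lucas term and [b] an even Fibonacci term. *)
- rewrite (_ : \prod_(_ <= _ < _) _ = \prod_(1 <= k < (2 * q).+1)
      (((golden R ^+ (2 * n - 1)) ^+ (2 * k - 1) + 1)
       / ((golden R ^+ (2 * n - 1)) ^+ (2 * k - 1) - 1))); last first.
    apply: eq_big_nat => k /andP[k0 _]; rewrite -coth_half_odd; last by rewrite oddM; lia.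
    by rewrite -exprM mulnC.
  apply: (infprod_sinh (golden_pow_gt1 R _ _) (oner_neq0 R)) => [|k k0|]; first lia.
  + by rewrite mul1r -!exprM lucas_odd 1?mulnC // oddM; lia.
  + by rewrite mul1r -!exprM fib_even 1?mulnC // !oddM; lia.
(* Same [x] with odd [s = 2 * q - 1]: the parities of [a k] and [b] swap, since [2 * (k + q - 1)] is
   the sum of [2 * k - 1] and [2 * q - 1]. *)
- rewrite (_ : \prod_(_ <= _ < _) _ = \prod_(1 <= k < (2 * q - 1).+1)
      (((golden R ^+ (2 * n - 1)) ^+ (2 * k - 1) + 1)
       / ((golden R ^+ (2 * n - 1)) ^+ (2 * k - 1) - 1))); last first.
    apply: eq_big_nat => k /andP[k0 _]; rewrite -coth_half_odd; last by rewrite oddM; lia.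
    by rewrite -exprM mulnC.
  apply: (infprod_sinh (golden_pow_gt1 R _ _) (oner_neq0 R)) => [|k k0|]; first lia.
  + rewrite mul1r -!exprM fib_even; last by rewrite !oddM; lia.
    by rewrite (_ : (2 * (2 * n - 1) * (k + q - 1)
                     = (2 * n - 1) * (2 * k - 1 + (2 * q - 1)))%N) //; nia.
  + by rewrite mul1r -!exprM lucas_odd // oddM; lia.
Qed.
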